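(* Let $A_G$ be a $G$-graded algebra over a field $\mathbb{F}$, let $W_G$ be a $G$-graded left $A_G$-module and let $\alpha\in Z^2(G,\mathbb{F}^* )$ be any 2-cocycle. Then $g(\alpha(W_G))\stackrel{G}{\cong}\alpha(g(W_G))$ for every $g\in G$. In particular, $\mathcal{I}(W_G)=\mathcal{I}(\alpha(W_G))$.
   Context: Algebras are associative and unital. A $G$-graded $\mathbb{F}$-algebra is $A_G=\bigoplus_{g\in G}A_g$ with $A_gA_h\subseteq A_{gh}$; a $G$-graded left $A_G$-module is $W_G=\bigoplus_gW_g$ with $A_gW_h\subseteq W_{gh}$; $\stackrel{G}{\cong}$ denotes degree-preserving isomorphism of graded modules. For $\alpha\in Z^2(G,\mathbb{F}^* )$ (trivial action), $\mathbb{F}^{\alpha}G=\bigoplus_g\mathbb{F}v_g$, $v_gv_h=\alpha(g,h)v_{gh}$. The twisted algebra is $\alpha(A_G)=\bigoplus_g\mathbb{F}v_g\otimes_{\mathbb{F}}A_g\subseteq\mathbb{F}^{\alpha}G\otimes_{\mathbb{F}}A_G$, and the twisted module is $\alpha(W_G)=\bigoplus_g\mathbb{F}v_g\otimes_{\mathbb{F}}W_g$, a graded $\alpha(A_G)$-module by $(v_g\otimes a_g)(v_h\otimes w_h)=v_gv_h\otimes a_gw_h$. The suspension $g(W_G)$ is the same module regraded by $g(W_G)_k:=W_{kg}$ (and likewise for graded $\alpha(A_G)$-modules). The inertia of a graded module is $\mathcal{I}(W_G)=\{g\in G: W_G\stackrel{G}{\cong}g(W_G)\}$; for $\alpha(W_G)$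 the isomorphisms are of graded $\alpha(A_G)$-modules. *)

(* Defs.v *)
From HB Require Import structures.
From mathcomp Require Import all_boot all_order all_algebra.
From mathcomp Require Import finmap boolp classical_sets.
From mathcomp Require Import monalg.

Set Implicit Arguments.
Unset Strict Implicit.
Unset Printing Implicit Defensive.

Import GRing.Theory.

Local Open Scope ring_scope.
Local Open Scope quotient_scope.

(* Associative unital algebras over F, as rings with a central ring morphism *)
(* from F.  The library's [algType F] is not used because it also requires   *)
(* 1 != 0, which would exclude the zero algebra.                             *)

HB.mixin Record isUnitalAlgebra (F : fieldType) A of GRing.PzRing A := {
  scal : F -> A;
  scal1 : scal 1 = 1;
  scalD : {morph scal : a b / a + b};
  scalM : {morph scal : a b / a * b};
  scalC : forall (a : F) (x : A), scal a * x = x * scal a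
}.

#[short(type="unitalAlgType")]
HB.structure Definition UnitalAlgebra (F : fieldType) :=
  {A of GRing.PzRing A & isUnitalAlgebra F A}.

Arguments scal {F s} _.

(* The F-vector space underlying a left A-module W (in particular A^o). *)
Definition vsp (F : fieldType) (A : unitalAlgType F) (W : lmodType A) : Type :=
  W.

Section VectorSpace.
Variables (F : fieldType) (A : unitalAlgType F) (W : lmodType A).

HB.instance Definition _ := GRing.Zmodule.on (vsp W).

Let vscale (a : F) (w : vsp W) : vsp W := (scal a : A) *: (w : W).

Let vscaleA a b w : vscale a (vscale b w) = vscale (a * b) w.
Proof. by rewrite /vscale scalerA scalM. Qed.

Let vscale1 : left_id 1 vscale.
Proof. by move=> w; rewrite /vscale scal1 scale1r. Qed.

Let vscaleDr : right_distributive vscale +%R.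
Proof. by move=> a u v; rewrite /vscale scalerDr. Qed.

Let vscaleDl w : {morph vscale^~ w : a b / a + b}.
Proof. by move=> a b; rewrite /vscale scalD scalerDl. Qed.

HB.instance Definition _ := GRing.Zmodule_isLmodule.Build F (vsp W)
  vscaleA vscale1 vscaleDr vscaleDl.

Lemma vspZ (a : F) (w : vsp W) : a *: w = (scal a : A) *: (w : W) :> W.
Proof. by []. Qed.

End VectorSpace.

(* Tensor products of vector spaces: formal sums of pairs, modulo the        *)
(* congruence generated by the bilinearity relations.                        *)

Section TensorRel.
Variables (F : fieldType) (U V : lmodType F).

Inductive tens_rel : seq (U * V) -> seq (U * V) -> Prop :=
| tens_refl s : tens_rel s s
| tens_sym s t : tens_rel s t -> tens_rel t s
| tens_trans s t r : tens_rel s t -> tens_rel t r -> tens_rel s r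
| tens_cat s s' t t' :
    tens_rel s s' -> tens_rel t t' -> tens_rel (s ++ t) (s' ++ t')
| tens_swap s t : tens_rel (s ++ t) (t ++ s)
| tens_zero v : tens_rel [:: (0, v)] [::]
| tens_addl u u' v : tens_rel [:: (u + u', v)] [:: (u, v); (u', v)]
| tens_addr u v v' : tens_rel [:: (u, v + v')] [:: (u, v); (u, v')]
| tens_scale a u v : tens_rel [:: (a *: u, v)] [:: (u, a *: v)].

Definition tens_relb : rel (seq (U * V)) := fun s t => `[< tens_rel s t >].

Let tens_relb_refl : reflexive tens_relb.
Proof. by move=> s; apply/asboolP/tens_refl. Qed.

Let tens_relb_sym : symmetric tens_relb.
Proof.
by move=> s t; apply/asboolP/asboolP => h; apply: tens_sym.
Qed.

Let tens_relb_trans : transitive tens_relb.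
Proof.
by move=> t s r /asboolP st /asboolP tr; apply/asboolP/(tens_trans st).
Qed.

Canonical tens_equiv :=
  EquivRel tens_relb tens_relb_refl tens_relb_sym tens_relb_trans.

Definition tensor : Type := {eq_quot tens_equiv}.

HB.instance Definition _ := Choice.on tensor.
HB.instance Definition _ := Quotient.on tensor.
HB.instance Definition _ := EqQuotient.on tensor.

End TensorRel.

Section Tensor.
Variables (F : fieldType) (U V : lmodType F).
Local Notation T := (tensor U V).
Implicit Types (s t : seq (U * V)) (x y z : T).

Definition tclass s : T := \pi_T s.

Lemma tclassW (P : T -> Prop) : (forall s, P (tclass s)) -> forall x, P x.
Proof. exact: quotW. Qed.

Lemma tens_eq s t : tens_rel s t -> tclass s = tclass t.
Proof. by move=> h; apply/eqP; rewrite piE; apply/asboolP. Qed.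

Lemma tens_repr s : tens_rel (repr (tclass s)) s.
Proof.
have /eqP := reprK (tclass s); rewrite /tclass -[X in _ == X]/(\pi_T s).
by rewrite piE => /asboolP.
Qed.

Definition pure (u : U) (v : V) : T := tclass [:: (u, v)].

Definition tadd x y : T := tclass (repr x ++ repr y).
Definition topp x : T := tclass [seq (- p.1, p.2) | p <- repr x].
Definition tscale (a : F) x : T := tclass [seq (a *: p.1, p.2) | p <- repr x].

Let tadd_pi s t : tadd (tclass s) (tclass t) = tclass (s ++ t).
Proof. by apply/tens_eq/tens_cat; apply: tens_repr. Qed.

Let tmap_rel (f : U -> U) :
    {morph f : u u' / u + u'} -> f 0 = 0 -> (forall a, {morph f : u / a *: u}) ->
  forall s t, tens_rel s t ->
    tens_rel [seq (f p.1, p.2) | p <- s] [seq (f p.1, p.2) | p <- t].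
Proof.
move=> fD f0 fZ s t; elim=> /=.
- by move=> r; apply: tens_refl.
- by move=> r q _; apply: tens_sym.
- by move=> ? ? ? _ h _; apply: tens_trans h.
- by move=> r r' q q' _ h _ h'; rewrite !map_cat; apply: tens_cat.
- by move=> r q; rewrite !map_cat; apply: tens_swap.
- by move=> v; rewrite f0; apply: tens_zero.
- by move=> u u' v; rewrite fD; apply: tens_addl.
- by move=> u v v'; apply: tens_addr.
- by move=> a u v; rewrite fZ; apply: tens_scale.
Qed.

Let topp_pi s : topp (tclass s) = tclass [seq (- p.1, p.2) | p <- s].
Proof.
apply: tens_eq; apply: (@tmap_rel -%R); last exact: tens_repr.
- by move=> u u'; rewrite opprD.
- exact: oppr0.
- by move=> a u; rewrite scalerN.
Qed.

Let tscale_pi a s : tscale a (tclass s) = tclass [seq (a *: p.1, p.2) | p <- s].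
Proof.
apply: tens_eq; apply: (@tmap_rel ( *:%R a)); last exact: tens_repr.
- by move=> u u'; rewrite scalerDr.
- exact: scaler0.
- by move=> b u; rewrite !scalerA mulrC.
Qed.

Let taddA : associative tadd.
Proof.
by move=> x y z; elim/tclassW: x => s; elim/tclassW: y => t; elim/tclassW: z => r; rewrite !tadd_pi catA.
Qed.

Let taddC : commutative tadd.
Proof.
by move=> x y; elim/tclassW: x => s; elim/tclassW: y => t; rewrite !tadd_pi; apply/tens_eq/tens_swap.
Qed.

Let tadd0 : left_id (tclass [::]) tadd.
Proof. by move=> x; elim/tclassW: x => s; rewrite tadd_pi. Qed.

Let taddN : left_inverse (tclass [::]) topp tadd.
Proof.
move=> x; elim/tclassW: x => s; rewrite topp_pi tadd_pi; apply/tens_eq.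
elim: s => [|[u v] s IHs] /=; first exact: tens_refl.
rewrite -cat1s -[_ :: s]cat1s.
set s' := map _ _ in IHs *.
apply: (@tens_trans _ _ _ _ (([:: (- u, v)] ++ [:: (u, v)]) ++ (s' ++ s))).
  rewrite -!catA; apply: tens_cat; first exact: tens_refl.
  rewrite !catA; apply: tens_cat; last exact: tens_refl.
  exact: tens_swap.
rewrite -[[::] in X in tens_rel _ X]cat0s; apply: tens_cat => //.
apply: tens_trans (tens_zero _ v).
by apply: tens_sym; rewrite -[X in (X, v)](addNr u); apply: tens_addl.
Qed.

HB.instance Definition _ := GRing.isZmodule.Build T taddA taddC tadd0 taddN.

Lemma piD s t : tclass (s ++ t) = tclass s + tclass t.
Proof. by rewrite -tadd_pi. Qed.

Let tscaleA a b x : tscale a (tscale b x) = tscale (a * b) x.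
Proof.
elim/tclassW: x => s; rewrite !tscale_pi -map_comp; congr (tclass _).
by apply: eq_map => p /=; rewrite scalerA.
Qed.

Let tscale1 : left_id 1 tscale.
Proof.
move=> x; elim/tclassW: x => s; rewrite tscale_pi; congr (tclass _).
by rewrite -[RHS]map_id; apply: eq_map => -[u v] /=; rewrite scale1r.
Qed.

Let tscaleDr : right_distributive tscale +%R.
Proof.
move=> a x y; elim/tclassW: x => s; elim/tclassW: y => t.
by rewrite -piD !tscale_pi map_cat piD.
Qed.

Let tscaleDl x : {morph tscale^~ x : a b / a + b}.
Proof.
elim/tclassW: x => s a b /=; rewrite !tscale_pi.
elim: s => [|[u v] s IHs] /=; first by rewrite -piD.
rewrite -cat1s -[X in _ = tclass X + _]cat1s -[X in _ = _ + tclass X]cat1s.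
rewrite !piD IHs addrACA; congr (_ + _).
by rewrite -piD scalerDl; apply/tens_eq/tens_addl.
Qed.

HB.instance Definition _ := GRing.Zmodule_isLmodule.Build F T
  tscaleA tscale1 tscaleDr tscaleDl.

Lemma pureDl u u' v : pure (u + u') v = pure u v + pure u' v.
Proof. by rewrite -piD; apply/tens_eq/tens_addl. Qed.

Lemma pureDr u v v' : pure u (v + v') = pure u v + pure u v'.
Proof. by rewrite -piD; apply/tens_eq/tens_addr. Qed.

Lemma pureZl a u v : pure (a *: u) v = a *: pure u v.
Proof. exact: (esym (tscale_pi a [:: (u, v)])). Qed.

Lemma pureZ a u v : pure (a *: u) v = pure u (a *: v).
Proof. exact/tens_eq/tens_scale. Qed.

Lemma pureZr a u v : pure u (a *: v) = a *: pure u v.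
Proof. by rewrite -pureZ pureZl. Qed.

Lemma pure0r u : pure u 0 = 0.
Proof. by rewrite -[X in pure u X](scale0r (0 : V)) pureZr scale0r. Qed.

Lemma pure0l v : pure 0 v = 0.
Proof. by rewrite -(scale0r (0 : U)) pureZl scale0r. Qed.

Lemma pure_sumr u (I : Type) (r : seq I) (f : I -> V) :
  pure u (\sum_(i <- r) f i) = \sum_(i <- r) pure u (f i).
Proof. exact: (big_morph (pure u) (pureDr u) (pure0r u)). Qed.

Lemma pi_sum s : tclass s = \sum_(p <- s) pure p.1 p.2.
Proof.
elim: s => [|[u v] s IHs]; first by rewrite big_nil.
by rewrite big_cons -IHs -piD.
Qed.

Lemma tensor_ind (P : T -> Prop) :
    P 0 -> (forall u v x, P x -> P (pure u v + x)) -> forall x, P x.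
Proof.
move=> P0 PD x; elim/tclassW: x; elim=> [|[u v] s IHs] //.
by rewrite -cat1s piD; apply: PD.
Qed.

Definition bilinear_map (M : lmodType F) (f : U -> V -> M) : Prop :=
  [/\ forall u u' v, f (u + u') v = f u v + f u' v,
      forall u v v', f u (v + v') = f u v + f u v',
      forall a u v, f (a *: u) v = a *: f u v &
      forall a u v, f u (a *: v) = a *: f u v].

(* The linear map induced by f; meaningful when f is bilinear. *)
Definition tlift (M : lmodType F) (f : U -> V -> M) (x : T) : M :=
  \sum_(p <- repr x) f p.1 p.2.

Section Lift.
Variables (M : lmodType F) (f : U -> V -> M).
Hypothesis f_bil : bilinear_map f.

Let tlift_rel s t : tens_rel s t ->
  \sum_(p <- s) f p.1 p.2 = \sum_(p <- t) f p.1 p.2.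
Proof.
have [fDl fDr fZl fZr] := f_bil; elim=> //=.
- by move=> r q w _ -> _ ->.
- by move=> r r' q q' _ h _ h'; rewrite !big_cat /= h h'.
- by move=> r q; rewrite !big_cat /= addrC.
- move=> v; rewrite big_seq1 big_nil /=.
  by rewrite -(scale0r (0 : U)) fZl scale0r.
- by move=> u u' v; rewrite big_seq1 !big_cons big_nil addr0 /= fDl.
- by move=> u v v'; rewrite big_seq1 !big_cons big_nil addr0 /= fDr.
- by move=> a u v; rewrite !big_seq1 /= fZl fZr.
Qed.

Lemma tlift_pi s : tlift f (tclass s) = \sum_(p <- s) f p.1 p.2.
Proof. exact/tlift_rel/tens_repr. Qed.

Lemma tlift_pure u v : tlift f (pure u v) = f u v.
Proof. by rewrite tlift_pi big_seq1. Qed.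

Lemma tliftD : {morph tlift f : x y / x + y}.
Proof.
move=> x y; elim/tclassW: x => s; elim/tclassW: y => t.
by rewrite -piD !tlift_pi big_cat.
Qed.

Lemma tlift0 : tlift f 0 = 0.
Proof. by apply: (addrI (tlift f 0)); rewrite -tliftD !addr0. Qed.

Lemma tliftZ a x : tlift f (a *: x) = a *: tlift f x.
Proof.
have [_ _ fZl _] := f_bil.
elim/tensor_ind: x => [|u v x IHx]; first by rewrite scaler0 tlift0 scaler0.
by rewrite scalerDr !tliftD -pureZl !tlift_pure fZl IHx scalerDr.
Qed.

Lemma tlift_sum (I : Type) (r : seq I) (g : I -> T) :
  tlift f (\sum_(i <- r) g i) = \sum_(i <- r) tlift f (g i).
Proof. exact: (big_morph (tlift f) tliftD tlift0). Qed.

End Lift.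
End Tensor.

Section TensorAlgebra.
Variables (F : fieldType) (B A : unitalAlgType F).

Section Act.
Variables (C : lmodType B) (W : lmodType A).
Local Notation TA := (tensor (vsp B^o) (vsp A^o)).
Local Notation TW := (tensor (vsp C) (vsp W)).

Let act1_fun (b : B) (a : A) (c : vsp C) (w : vsp W) : TW :=
  pure ((b *: (c : C)) : vsp C) ((a *: (w : W)) : vsp W).

Let act1_bil b a : bilinear_map (act1_fun b a).
Proof.
split=> [c c' w|c w w'|k c w|k c w]; rewrite /act1_fun.
- by rewrite scalerDr pureDl.
- by rewrite scalerDr pureDr.
- by rewrite -pureZl !vspZ !scalerA scalC.
- by rewrite -pureZr !vspZ !scalerA scalC.
Qed.

Let act1 b a : TW -> TW := tlift (act1_fun b a).

Let act_bil (z : TW) : @bilinear_map F (vsp B^o) (vsp A^o) TW (fun b a => act1 b a z).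
Proof.
split=> [b b' a|b a a'|k b a|k b a]; elim/tensor_ind: z => [|c w z IHz];
  rewrite /act1 ?(tlift0 (act1_bil _ _)) ?addr0 ?scaler0 //.
- rewrite !(tliftD (act1_bil _ _)) !(tlift_pure (act1_bil _ _)) addrACA -IHz.
  by rewrite /act1_fun scalerDl pureDl.
- rewrite !(tliftD (act1_bil _ _)) !(tlift_pure (act1_bil _ _)) addrACA -IHz.
  by rewrite /act1_fun scalerDl pureDr.
- rewrite !(tliftD (act1_bil _ _)) !(tlift_pure (act1_bil _ _)) scalerDr -IHz.
  by rewrite /act1_fun -pureZl !vspZ !scalerA.
- rewrite !(tliftD (act1_bil _ _)) !(tlift_pure (act1_bil _ _)) scalerDr -IHz.
  by rewrite /act1_fun -pureZr !vspZ !scalerA.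
Qed.

(* (b ⊗ a) acts on c ⊗ w by (b c) ⊗ (a w). *)
Definition tact (x : TA) (z : TW) : TW :=
  tlift (fun (b : vsp B^o) (a : vsp A^o) => act1 b a z) x.

Lemma tact_pure (b : B) (a : A) (c : C) (w : W) :
  tact (@pure F (vsp B^o) (vsp A^o) b a) (@pure F (vsp C) (vsp W) c w) =
  @pure F (vsp C) (vsp W) (b *: c) (a *: w).
Proof. exact: (etrans (tlift_pure (act_bil _) _ _) (tlift_pure (act1_bil _ _) _ _)). Qed.

Lemma tactDl z : {morph tact^~ z : x y / x + y}.
Proof. exact: (tliftD (act_bil z)). Qed.

Lemma tact0l z : tact 0 z = 0.
Proof. exact: (tlift0 (act_bil z)). Qed.

Lemma tactDr x : {morph tact x : z z' / z + z'}.
Proof.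
move=> z z'; elim/tensor_ind: x => [|b a x IHx]; first by rewrite !tact0l addr0.
rewrite !tactDl IHx addrACA; congr (_ + _).
by rewrite /tact !(tlift_pure (act_bil _)) /act1 (tliftD (act1_bil _ _)).
Qed.

Lemma tact0r x : tact x 0 = 0.
Proof. by apply: (addrI (tact x 0)); rewrite -tactDr !addr0. Qed.

Lemma tactZl k x z : tact (k *: x) z = k *: tact x z.
Proof. exact: (tliftZ (act_bil z)). Qed.

Lemma tactZr k x z : tact x (k *: z) = k *: tact x z.
Proof.
elim/tensor_ind: x => [|b a x IHx]; first by rewrite !tact0l scaler0.
rewrite !tactDl IHx scalerDr; congr (_ + _).
by rewrite /tact !(tlift_pure (act_bil _)) /act1 (tliftZ (act1_bil _ _)).
Qed.

End Act.

Definition talg : Type := tensor (vsp B^o) (vsp A^o).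
HB.instance Definition _ := GRing.Zmodule.on talg.

Definition tone : talg := @pure F (vsp B^o) (vsp A^o) 1 1.
Definition tmul (x y : talg) : talg := tact (C := B^o) (W := A^o) x y.

Section ActTheory.
Variables (C : lmodType B) (W : lmodType A).

Lemma tactA (x y : talg) (z : tensor (vsp C) (vsp W)) :
  tact x (tact y z) = tact (tmul x y) z.
Proof.
rewrite /tmul.
elim/tensor_ind: x => [|b a x IHx]; first by rewrite !tact0l.
rewrite !tactDl IHx; congr (_ + _) => {IHx}.
elim/tensor_ind: y => [|b' a' y IHy]; first by rewrite tact0l !tact0r tact0l.
rewrite tactDl !tactDr tactDl IHy; congr (_ + _) => {IHy}.
elim/tensor_ind: z => [|c w z IHz]; first by rewrite !tact0r.
by rewrite !tactDr IHz !tact_pure !scalerA.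
Qed.

Lemma tact1 (z : tensor (vsp C) (vsp W)) : tact tone z = z.
Proof.
elim/tensor_ind: z => [|c w z IHz]; first by rewrite tact0r.
by rewrite tactDr IHz tact_pure !scale1r.
Qed.

End ActTheory.

Let tmulA : associative tmul. Proof. by move=> x y z; apply: tactA. Qed.
Let tmul1 : left_id tone tmul. Proof. exact: tact1. Qed.

Let tmulr1 : right_id tone tmul.
Proof.
rewrite /tmul; move=> x; elim/tensor_ind: x => [|b a x IHx]; first by rewrite tact0l.
by rewrite tactDl IHx tact_pure /GRing.scale /= !mulr1.
Qed.

Let tmulDl : left_distributive tmul +%R.
Proof. by move=> x y z; apply: tactDl. Qed.

Let tmulDr : right_distributive tmul +%R.
Proof. by move=> x y z; apply: tactDr. Qed.

HB.instance Definition _ := GRing.Zmodule_isPzRing.Build talg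
  tmulA tmul1 tmulr1 tmulDl tmulDr.

Let tscal (a : F) : talg := a *: (tone : tensor (vsp B^o) (vsp A^o)).

Let tscal1 : tscal 1 = 1. Proof. exact: scale1r. Qed.
Let tscalD : {morph tscal : a b / a + b}.
Proof. by move=> a b; apply: scalerDl. Qed.
Let tscalM : {morph tscal : a b / a * b}.
Proof.
move=> a b; rewrite /GRing.mul /= /tmul /tscal tactZl tact1.
exact: (esym (scalerA _ _ _)).
Qed.
Let tscalC a (x : talg) : tscal a * x = x * tscal a.
Proof.
rewrite /GRing.mul /= /tmul /tscal tactZl tactZr.
by rewrite tact1; congr (a *: _); apply: (esym (tmulr1 x)).
Qed.

HB.instance Definition _ := isUnitalAlgebra.Build F talg
  tscal1 tscalD tscalM tscalC.

Definition tmod (C : lmodType B) (W : lmodType A) : Type :=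
  tensor (vsp C) (vsp W).

Section Mod.
Variables (C : lmodType B) (W : lmodType A).
HB.instance Definition _ := GRing.Zmodule.on (tmod C W).

Let mscale (x : talg) (z : tmod C W) : tmod C W := tact x z.
Let mscaleA x y z : mscale x (mscale y z) = mscale (x * y) z.
Proof. exact: tactA. Qed.
Let mscale1 : left_id 1 mscale. Proof. exact: tact1. Qed.
Let mscaleDr : right_distributive mscale +%R.
Proof. by move=> x; apply: tactDr. Qed.
Let mscaleDl z : {morph mscale^~ z : x y / x + y}.
Proof. exact: tactDl. Qed.

HB.instance Definition _ := GRing.Zmodule_isLmodule.Build talg (tmod C W)
  mscaleA mscale1 mscaleDr mscaleDl.
End Mod.

End TensorAlgebra.

(* 2-cocycles with values in F^* (trivial action), not assumed normalized:   *)
(* the unit of the twisted group algebra is alpha(1,1)^-1 v_1.               *)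

Record cocycle2 (G : groupType) (F : fieldType) := Cocycle2 {
  coc :> G -> G -> F;
  coc_neq0 : forall g h, coc g h != 0;
  cocP : forall g h k,
    coc g h * coc (g * h)%g k = coc h k * coc g (h * k)%g
}.

(* The group algebra FG as a vector space; alpha only selects the product. *)
Definition tga (G : groupType) (F : fieldType) (alpha : cocycle2 G F) : Type :=
  {malg F[G]}.

Section TwistedGroupAlgebra.
Variables (G : groupType) (F : fieldType) (alpha : cocycle2 G F).

Lemma coc1g g : alpha 1%g g = alpha 1%g 1%g.
Proof.
have /esym := cocP alpha 1%g 1%g g; rewrite !mul1g.
exact/mulIf/coc_neq0.
Qed.

Lemma cocg1 g : alpha g 1%g = alpha 1%g 1%g.
Proof.
have := cocP alpha g 1%g 1%g; rewrite !mulg1.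
exact/mulIf/coc_neq0.
Qed.

Local Notation tga := (tga alpha).

HB.instance Definition _ := GRing.Zmodule.on tga.

Definition vg (g : G) : tga := << 1 *g g >>.

Definition tga_mul (x y : tga) : tga :=
  \sum_(g <- msupp x) \sum_(h <- msupp y)
     << x@_g * y@_h * alpha g h *g (g * h)%g >>.

Definition tga_one : tga := << (alpha 1%g 1%g)^-1 *g 1%g >>.

Let mulE (d1 d2 : {fset G}) (x y : tga) :
  (msupp x `<=` d1)%fset -> (msupp y `<=` d2)%fset ->
  tga_mul x y = \sum_(g <- d1) \sum_(h <- d2)
     << x@_g * y@_h * alpha g h *g (g * h)%g >>.
Proof.
move=> le_d1 le_d2; rewrite /tga_mul (big_fset_incl _ le_d1) /=.
  apply/eq_bigr=> g _; apply/big_fset_incl => // h _ /mcoeff_outdom ->.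
  by rewrite mulr0 mul0r monalgU0.
move=> g _ /mcoeff_outdom xg.
by rewrite big1 => // h _; rewrite xg !mul0r monalgU0.
Qed.

Let mulUU c d g h : tga_mul << c *g g >> << d *g h >> =
  << c * d * alpha g h *g (g * h)%g >>.
Proof. by rewrite (mulE msuppU_le msuppU_le) !big_seq_fset1 !mcoeffUU. Qed.

Let mulDl : left_distributive tga_mul +%R.
Proof.
move=> x y z; rewrite [in RHS](mulE (fsubsetUl (msupp x) (msupp y)) (fsubset_refl _)).
rewrite [in RHS](mulE (fsubsetUr (msupp x) (msupp y)) (fsubset_refl _)).
rewrite (mulE (msuppD_le x y) (fsubset_refl _)).
rewrite -big_split /=; apply/eq_bigr=> g _.
rewrite -big_split /=; apply/eq_bigr=> h _.
by rewrite mcoeffD !mulrDl monalgUD.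
Qed.

Let mulDr : right_distributive tga_mul +%R.
Proof.
move=> z x y; rewrite [in RHS](mulE (fsubset_refl _) (fsubsetUl (msupp x) (msupp y))).
rewrite [in RHS](mulE (fsubset_refl _) (fsubsetUr (msupp x) (msupp y))).
rewrite (mulE (fsubset_refl _) (msuppD_le x y)).
rewrite -big_split /=; apply/eq_bigr=> g _.
rewrite -big_split /=; apply/eq_bigr=> h _.
by rewrite mcoeffD mulrDr mulrDl monalgUD.
Qed.

Lemma tga_ind (P : tga -> Prop) :
  P 0 -> (forall (c : F) (g : G) x, P x -> P (<< c *g g >> + x)) -> forall x, P x.
Proof.
move=> P0 PD x; rewrite (monalgE x).
elim: (enum_fset _) => [|g s IHs]; first by rewrite big_nil.
by rewrite big_cons; apply: PD.
Qed.

Let mul0x : left_zero 0 tga_mul.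
Proof. by move=> x; rewrite /tga_mul msupp0 big_seq_fset0. Qed.

Let mulx0 : right_zero 0 tga_mul.
Proof.
by move=> x; rewrite /tga_mul big1 // => g _; rewrite msupp0 big_seq_fset0.
Qed.

Let mulA : associative tga_mul.
Proof.
move=> x y z.
elim/tga_ind: x => [|a g x IHx]; first by rewrite !mul0x.
rewrite !mulDl IHx.
apply: (congr1 (fun u => u + _)) => {IHx}.
elim/tga_ind: y => [|b h y IHy]; first by rewrite !(mul0x, mulx0).
rewrite !(mulDl, mulDr) IHy.
apply: (congr1 (fun u => u + _)) => {IHy}.
elim/tga_ind: z => [|c k z IHz]; first by rewrite !mulx0.
rewrite !mulDr IHz.
apply: (congr1 (fun u => u + _)) => {IHz}.
rewrite !mulUU mulgA; congr << _ *g _ >>.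
rewrite -!mulrA; congr (_ * (_ * _)).
by rewrite [RHS]mulrCA (cocP alpha) mulrA.
Qed.

Let mul1x : left_id tga_one tga_mul.
Proof.
move=> x; elim/tga_ind: x => [|c g x IHx]; first exact: mulx0.
rewrite mulDr IHx mulUU coc1g mul1g; congr (<< _ *g _ >> + _).
by rewrite mulrC mulrA mulfV ?coc_neq0 ?mul1r.
Qed.

Let mulx1 : right_id tga_one tga_mul.
Proof.
move=> x; elim/tga_ind: x => [|c g x IHx]; first exact: mul0x.
by rewrite mulDl IHx mulUU cocg1 mulg1 mulfVK ?coc_neq0.
Qed.

HB.instance Definition _ := GRing.Zmodule_isPzRing.Build tga
  mulA mul1x mulx1 mulDl mulDr.

Lemma tga_mulUU c d g h : (<< c *g g >> : tga) * << d *g h >> =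
  << c * d * alpha g h *g (g * h)%g >>.
Proof. exact: mulUU. Qed.

Let tga_scal (c : F) : tga := << c / alpha 1%g 1%g *g 1%g >>.
Let tga_scal1 : tga_scal 1 = 1.
Proof. by rewrite /tga_scal mul1r. Qed.
Let tga_scalD : {morph tga_scal : c d / c + d}.
Proof. by move=> c d; rewrite /tga_scal mulrDl monalgUD. Qed.
Let tga_scalM : {morph tga_scal : c d / c * d}.
Proof.
move=> c d; rewrite /tga_scal tga_mulUU mulg1; congr << _ *g _ >>.
by rewrite -[RHS]mulrA mulfVK ?coc_neq0 // mulrAC.
Qed.

Let tga_scalE c (x : tga) : tga_scal c * x = c *: (x : {malg F[G]}).
Proof.
elim/tga_ind: x => [|d g x IHx]; first by rewrite mulr0 scaler0.
rewrite mulrDr IHx scalerDr tga_mulUU coc1g mul1g; congr (_ + _).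
apply/malgP=> k; rewrite mcoeffZ !mcoeffU mulrnAr.
by rewrite [X in X *+ _]mulrAC mulfVK ?coc_neq0.
Qed.

Let tga_scalC c (x : tga) : tga_scal c * x = x * tga_scal c.
Proof.
elim/tga_ind: x => [|d g x IHx]; first by rewrite mulr0 mul0r.
rewrite mulrDr mulrDl IHx !tga_mulUU coc1g cocg1 mul1g mulg1.
by rewrite [d * _]mulrC.
Qed.

HB.instance Definition _ := isUnitalAlgebra.Build F tga
  tga_scal1 tga_scalD tga_scalM tga_scalC.

Lemma tgaZ c (x : vsp tga^o) : c *: x = c *: (x : {malg F[G]}).
Proof. exact: tga_scalE. Qed.

Lemma vgM g h : (vg g * vg h : vsp tga^o) = alpha g h *: (vg (g * h)%g : vsp tga^o).
Proof.
rewrite tgaZ tga_mulUU !mul1r; apply/malgP=> k.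
by rewrite mcoeffZ !mcoeffU mulrnAr mulr1.
Qed.

End TwistedGroupAlgebra.

Arguments vg {G F} alpha g.

Lemma big_pred1_uniq (I : eqType) (M : nmodType) (s : seq I) i (f : I -> M) :
  uniq s -> i \in s -> \sum_(j <- s | j == i) f j = f i.
Proof. by move=> s_uniq ?; rewrite -big_filter filter_pred1_uniq // big_seq1. Qed.

Section Gradings.
Variables (G : groupType) (F : fieldType).

Section Def.
Variable V : lmodType F.

(* The elements of the (not necessarily direct) sum of the subspaces V_ g. *)
Definition sumsub (V_ : G -> {pred V}) : {pred V} := [pred x | `[<
  exists (s : seq G) (f : G -> V),
    (forall g, f g \in V_ g) /\ x = \sum_(g <- s) f g >]].

Definition independent (V_ : G -> {pred V}) : Prop :=
  forall (s : seq G) (f : G -> V), uniq s -> (forall g, f g \in V_ g) ->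
    \sum_(g <- s) f g = 0 -> forall g, g \in s -> f g = 0.

Definition is_grading (V_ : G -> {pred V}) : Prop :=
  [/\ forall g, submod_closed (V_ g),
      forall x, x \in sumsub V_ &
      independent V_].

Record grading := Grading {
  gcomp :> G -> {pred V};
  gcompP : is_grading gcomp
}.

Section Submod.
Variable V_ : G -> {pred V}.
Hypothesis V_sub : forall g, submod_closed (V_ g).

Let V0 g : 0 \in V_ g. Proof. by case: (V_sub g). Qed.
Let VD g x y : x \in V_ g -> y \in V_ g -> x + y \in V_ g.
Proof. by case: (V_sub g) => _ h *; rewrite -[x]scale1r; apply: h. Qed.
Let VZ g a x : x \in V_ g -> a *: x \in V_ g.
Proof. by case: (V_sub g) => h0 h ?; rewrite -[_ *: _]addr0; apply: h. Qed.

Let pairs_decomp (s : seq (G * V)) : (forall p, p \in s -> p.2 \in V_ p.1) ->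
  exists (t : seq G) (f : G -> V),
    [/\ uniq t, forall g, f g \in V_ g & \sum_(p <- s) p.2 = \sum_(g <- t) f g].
Proof.
move=> sV; exists (undup (map fst s)).
exists (fun g => \sum_(p <- s | p.1 == g) p.2); split=> [|g|].
- exact: undup_uniq.
- rewrite big_seq_cond; apply: (big_ind (fun u => u \in V_ g)) => //.
    by move=> u v; apply: VD.
  by move=> p /andP[/sV + /eqP<-].
rewrite (exchange_big_dep xpredT) //= [LHS]big_seq [RHS]big_seq.
apply: eq_bigr => p ps; under eq_bigl do rewrite eq_sym.
by rewrite big_pred1_uniq ?undup_uniq // mem_undup map_f.
Qed.

Lemma sumsubP x : x \in sumsub V_ <-> exists s : seq (G * V),
  (forall p, p \in s -> p.2 \in V_ p.1) /\ x = \sum_(p <- s) p.2.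
Proof.
split=> [/asboolP[s [f [fV ->]]]|[s [/pairs_decomp[t [f [_ fV ->]]] ->]]].
  exists [seq (g, f g) | g <- s]; split; last by rewrite big_map.
  by move=> p /mapP[g _ ->]; apply: fV.
by apply/asboolP; exists t, f.
Qed.

Lemma sumsub_decomp x : x \in sumsub V_ -> exists (s : seq G) (f : G -> V),
  [/\ uniq s, forall g, f g \in V_ g & x = \sum_(g <- s) f g].
Proof. by case/sumsubP=> s [/pairs_decomp[t [f [? ? ->]]] ->]; exists t, f. Qed.

Lemma sumsub_comp g x : x \in V_ g -> x \in sumsub V_.
Proof.
move=> xV; apply/sumsubP; exists [:: (g, x)]; rewrite big_seq1; split=> // p.
by rewrite inE => /eqP->.
Qed.

Lemma sumsub_submod : submod_closed (sumsub V_).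
Proof.
split; first by apply/sumsubP; exists [::]; rewrite big_nil.
move=> a x y /sumsubP[s [sV ->]] /sumsubP[t [tV ->]]; apply/sumsubP.
exists ([seq (p.1, a *: p.2) | p <- s] ++ t); split=> [p|].
  rewrite mem_cat => /orP[/mapP[q /sV qV ->]|/tV] //=; exact: VZ.
by rewrite big_cat big_map /= scaler_sumr.
Qed.

Lemma sumsubD x y : x \in sumsub V_ -> y \in sumsub V_ -> x + y \in sumsub V_.
Proof.
by case: sumsub_submod => _ h hx hy; rewrite -[x]scale1r; apply: h.
Qed.

Lemma sumsub0 : 0 \in sumsub V_.
Proof. by case: sumsub_submod. Qed.

End Submod.

Lemma is_grading_shift (V_ : G -> {pred V}) h : is_grading V_ -> is_grading (fun k => V_ (k * h)%g).
Proof.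
case=> V_sub V_sum V_ind; split=> [g|x|s f s_uniq fV sum0 g gs] //.
  have /asboolP[s [f [fV ->]]] := V_sum x; apply/asboolP.
  exists [seq (g * h^-1)%g | g <- s], (fun k => f (k * h)%g); split=> //.
  by rewrite big_map; apply: eq_bigr => g _; rewrite mulgVK.
have := V_ind [seq (k * h)%g | k <- s] (fun k => f (k * h^-1)%g) _ _ _ (g * h)%g.
rewrite mulgK => -> //.
- by rewrite map_inj_uniq //; apply: mulIg.
- by move=> k; have := fV (k * h^-1)%g; rewrite mulgVK.
- by rewrite big_map -[RHS]sum0; apply: eq_bigr => k _; rewrite mulgK.
- by apply/mapP; exists g.
Qed.

Definition shift (V_ : grading) (h : G) : grading :=
  Grading (is_grading_shift h (gcompP V_)).

End Def.

Lemma is_grading_preim (S T : lmodType F) (f : S -> T) (T_ : G -> {pred T}) :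
    {morph f : x y / x + y} -> (forall a, {morph f : x / a *: x}) ->
    injective f -> (forall g, submod_closed (T_ g)) -> independent T_ ->
    (forall y, y \in sumsub T_ <-> exists x, f x = y) ->
  is_grading (fun g => [pred x | f x \in T_ g]).
Proof.
move=> fD fZ f_inj T_sub T_ind f_im.
have f0 : f 0 = 0 by rewrite -[X in f X](scale0r 0) fZ scale0r.
have f_sum (s : seq G) (e : G -> S) :
  f (\sum_(g <- s) e g) = \sum_(g <- s) f (e g) by exact: (big_morph f fD f0).
split=> [g|x|s e s_uniq eT sum0 g gs].
- split=> [|a x y]; rewrite !inE ?f0; first by case: (T_sub g).
  by rewrite fD fZ; case: (T_sub g) => _; apply.
- have /asboolP[s [e [eT xE]]] : f x \in sumsub T_ by apply/f_im; exists x.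
  have /choice[e' e'E] : forall g, exists y, f y = e g.
    by move=> g; apply/f_im/(sumsub_comp T_sub (eT g)).
  apply/asboolP; exists s, e'; split=> [g|]; first by rewrite inE e'E.
  by apply: f_inj; rewrite f_sum xE; apply: eq_bigr => g _; rewrite e'E.
- apply: f_inj; rewrite f0; apply: (T_ind s (f \o e)) => //=.
  by rewrite -f_sum sum0.
Qed.

End Gradings.

(* That 1 has degree 1 is a consequence, see acomp1. *)
Record gradedAlg (G : groupType) (F : fieldType) := GradedAlg {
  galg :> unitalAlgType F;
  acomp : grading G (vsp galg^o);
  acompM : forall g h (a b : galg),
    a \in acomp g -> b \in acomp h -> a * b \in acomp (g * h)%g
}.

Record gradedMod (G : groupType) (F : fieldType) (A : gradedAlg G F) :=
  GradedMod {
  gmod :> lmodType A;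
  mcomp : grading G (vsp gmod);
  mcompZ : forall g h (a : A) (w : gmod),
    a \in acomp A g -> w \in mcomp h -> a *: w \in mcomp (g * h)%g
}.

Lemma acomp1 (G : groupType) (F : fieldType) (A : gradedAlg G F) :
  (1 : A) \in acomp A 1%g.
Proof.
have [A_sub A_sum _] := gcompP (acomp A).
have A0 g : 0 \in acomp A g by case: (A_sub g).
have AD g (x y : A) : x \in acomp A g -> y \in acomp A g -> x + y \in acomp A g.
  by case: (A_sub g) => _ h hx hy; rewrite -[x](@scale1r F (vsp A^o)); apply: h.
have AN g (x : A) : x \in acomp A g -> - x \in acomp A g.
  move=> hx; rewrite -[- x](@scaleN1r F (vsp A^o)) -[_ *: _]addr0.
  by case: (A_sub g) => h0 h; apply: h.
have [s [f [s_uniq fA oneE]]] := sumsub_decomp A_sub (A_sum (1 : A)).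
pose e : A := if 1%g \in s then f 1%g else 0.
have eA : e \in acomp A 1%g by rewrite /e; case: ifP.
suff eK g (a : A) : a \in acomp A g -> e * a = a.
  suff <- : e = 1 by [].
  rewrite -[LHS]mulr1 [X in e * X]oneE mulr_sumr [RHS]oneE.
  by apply: eq_bigr => g _; apply: eK (fA g).
move=> aA; pose s' := undup (1%g :: s).
pose f' h : A := (if h \in s then f h else 0) * a - (if h == 1%g then a else 0).
have [_ _ ind] := is_grading_shift g (gcompP (acomp A)).
suff : f' 1%g = 0 by rewrite /f' eqxx => /eqP; rewrite subr_eq0 => /eqP.
apply: (ind s'); rewrite ?undup_uniq ?mem_undup ?mem_head //.
  move=> h; rewrite /f'; apply: AD.
    by apply: acompM aA; case: ifP.
  by apply: AN; case: eqP => [->|_]; rewrite ?mul1g.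
rewrite sumrB -mulr_suml -2!big_mkcond /= big_pred1_uniq ?undup_uniq //; last first.
  by rewrite mem_undup mem_head.
rewrite -big_filter (perm_big s) -?oneE ?mul1r ?subrr //.
apply: uniq_perm; rewrite ?filter_uniq ?undup_uniq // => h.
by rewrite mem_filter mem_undup inE; case: (h \in s); rewrite ?orbT.
Qed.

Section Twist.
Variables (G : groupType) (F : fieldType) (alpha : cocycle2 G F).

Section TwistSpace.
Variables (V : lmodType F) (V_ : grading G V).
Local Notation T := (tensor (vsp (tga alpha)^o) V).

Definition vtens (g : G) (v : V) : T :=
  pure (U := vsp (tga alpha)^o) (vg alpha g) v.

(* F v_g ⊗ V_g, whose elements are the v_g ⊗ v with v in V_g. *)
Definition twcomp (g : G) : {pred T} :=
  [pred x | `[< exists2 v, v \in V_ g & x = vtens g v >]].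

Lemma twcomp_submod g : submod_closed (twcomp g).
Proof.
have [+ _ _] := gcompP V_ => /(_ g)[V0 VL].
split; first by apply/asboolP; exists 0 => //; apply: (esym (pure0r _ _)).
move=> a _ _ /asboolP[v vV ->] /asboolP[w wV ->]; apply/asboolP.
by exists (a *: v + w); [apply: VL | rewrite /vtens pureDr pureZr].
Qed.

Definition coef (g : G) : T -> V :=
  tlift (fun (x : vsp (tga alpha)^o) v => (x : {malg F[G]})@_g *: v).

Let coef_bil g : @bilinear_map F (vsp (tga alpha)^o) V V
  (fun x v => (x : {malg F[G]})@_g *: v).
Proof.
split=> [x y v|x v w|a x v|a x v].
- by rewrite mcoeffD scalerDl.
- by rewrite scalerDr.
- by rewrite tgaZ mcoeffZ scalerA.
- by rewrite !scalerA mulrC.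
Qed.

Lemma coefD g : {morph coef g : x y / x + y}.
Proof. exact: (tliftD (coef_bil g)). Qed.

Lemma coef0 g : coef g 0 = 0.
Proof. exact: (tlift0 (coef_bil g)). Qed.

Lemma coefZ g a : {morph coef g : x / a *: x}.
Proof. exact: (tliftZ (coef_bil g)). Qed.

Lemma coef_sum g (I : Type) (r : seq I) (f : I -> T) :
  coef g (\sum_(i <- r) f i) = \sum_(i <- r) coef g (f i).
Proof. exact: (tlift_sum (coef_bil g)). Qed.

Lemma coef_pure g h v :
  coef g (vtens h v) = if h == g then v else 0.
Proof.
rewrite /coef /vtens (tlift_pure (coef_bil g)) mcoeffU.
by case: eqP => _; rewrite ?scale1r ?scale0r.
Qed.

Lemma twcomp_ind : independent twcomp.
Proof.
move=> s f s_uniq fV sum0 g gs.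
have cf h : coef g (f h) = if h == g then coef g (f g) else 0.
  case: eqP => [->//|/eqP hg]; have /asboolP[v _ ->] := fV h.
  by rewrite coef_pure (negPf hg).
have : coef g (f g) = 0.
  have := congr1 (coef g) sum0; rewrite coef_sum coef0 (eq_bigr _ (fun h _ => cf h)).
  by rewrite -big_mkcond big_pred1_uniq.
have /asboolP[v _ ->] := fV g; rewrite coef_pure eqxx => ->.
exact: pure0r.
Qed.

Definition twsum : {pred T} := sumsub twcomp.

Lemma twsum_closed : zmod_closed twsum.
Proof. exact/GRing.submod_closedB/sumsub_submod/twcomp_submod. Qed.

(* The subspace \bigoplus_g F v_g ⊗ V_g of F^alpha G ⊗ V. *)
Record twsp := Twsp { twval : T; twvalP : twval \in twsum }.

HB.instance Definition _ := [isSub for twval].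
HB.instance Definition _ := [Choice of twsp by <:].
HB.instance Definition _ := GRing.SubChoice_isSubZmodule.Build T twsum twsp
  twsum_closed.

Lemma twvalD : {morph twval : x y / x + y}.
Proof. exact: (raddfD (\val : twsp -> T)). Qed.

Lemma twval_im y : y \in twsum <-> exists x, twval x = y.
Proof. by split=> [h|[x <-]]; [exists (Twsp h) | apply: twvalP]. Qed.

Lemma is_grading_twsp (S : lmodType F) (f : S -> twsp) :
    {morph f : x y / x + y} -> (forall a x, twval (f (a *: x)) = a *: twval (f x)) ->
    bijective f ->
  is_grading (fun g => [pred x | twval (f x) \in twcomp g]).
Proof.
move=> fD fZ [f' fK f'K]; apply: (is_grading_preim (f := twval \o f)) => /=.
- by move=> x y; rewrite /= fD twvalD.
- by move=> a x; apply: fZ.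
- by apply: inj_comp (can_inj fK); apply: val_inj.
- exact: twcomp_submod.
- exact: twcomp_ind.
- move=> y; rewrite twval_im; split=> [[x <-]|[x <-]]; last by exists (f x).
  by exists (f' x); rewrite /= f'K.
Qed.

End TwistSpace.

Section TwistAction.
Variables (A : gradedAlg G F) (W : lmodType A) (W_ : grading G (vsp W)).
Hypothesis W_Z : forall g h (a : A) (w : W),
  a \in acomp A g -> w \in W_ h -> a *: w \in W_ (g * h)%g.
Local Notation act := (@tact F (tga alpha) A (tga alpha)^o W).

Lemma tact_vtens g h (a : A) (w : W) :
  act (@vtens (vsp A^o) g a) (@vtens (vsp W) h w) =
  @vtens (vsp W) (g * h)%g (alpha g h *: ((a *: w : W) : vsp W)).
Proof.
by rewrite [LHS]tact_pure [_ *: _]vgM /vtens pureZ.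
Qed.

Lemma tact_twcomp g h x z : x \in twcomp (acomp A) g -> z \in twcomp W_ h ->
  act x z \in twcomp W_ (g * h)%g.
Proof.
move=> /asboolP[a aA ->] /asboolP[w wW ->]; apply/asboolP.
exists (alpha g h *: ((a *: w : W) : vsp W)); last exact: tact_vtens.
have [+ _ _] := gcompP W_ => /(_ (g * h)%g)[W0 WL].
by rewrite -[_ *: _]addr0; apply: WL => //; apply: W_Z.
Qed.

Lemma tact_twsum x z : x \in twsum (acomp A) -> z \in twsum W_ ->
  act x z \in twsum W_.
Proof.
move=> /asboolP[s [f [fA ->]]] /asboolP[t [e [eW ->]]].
rewrite (big_morph (act^~ _) (tactDl _) (tact0l _)).
have tw_sub := twcomp_submod W_.
apply: (big_ind (fun y => y \in twsum W_)); first exact: sumsub0.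
  by move=> ? ?; apply: sumsubD.
move=> g _; rewrite (big_morph (act _) (tactDr _) (tact0r _ _ _)).
apply: (big_ind (fun y => y \in twsum W_)); first exact: sumsub0.
  by move=> ? ?; apply: sumsubD.
by move=> h _; apply: (sumsub_comp tw_sub) (tact_twcomp (fA g) (eW h)).
Qed.

End TwistAction.

Section TwistAlg.
Variable A : gradedAlg G F.
Local Notation T := (talg (tga alpha) A).

Definition twalg_sort : Type := twsp (acomp A).
HB.instance Definition _ := GRing.Zmodule.on twalg_sort.

Let oneP : (1 : T) \in twsum (acomp A).
Proof.
apply: (sumsub_comp (twcomp_submod _) (g := 1%g)); apply/asboolP.
exists ((alpha 1%g 1%g)^-1 *: (1 : vsp A^o)).
  have [+ _ _] := gcompP (acomp A) => /(_ 1%g)[A0 AL].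
  by rewrite -[_ *: _]addr0; apply: AL => //; apply: acomp1.
rewrite /vtens -pureZ tgaZ; congr pure.
by apply/malgP=> g; rewrite mcoeffZ !mcoeffU mulrnAr mulr1.
Qed.

Let scalP c : (scal c : T) \in twsum (acomp A).
Proof.
have [h0 h] := sumsub_submod (twcomp_submod (acomp A)).
by have := h c _ _ oneP h0; rewrite addr0.
Qed.

Let mulP (x y : T) : x \in twsum (acomp A) -> y \in twsum (acomp A) ->
  x * y \in twsum (acomp A).
Proof. exact: (tact_twsum (W := A^o) (@acompM G F A)). Qed.

Definition twalg_mul (x y : twalg_sort) : twalg_sort :=
  Twsp (mulP (twvalP x) (twvalP y)).
Definition twalg_one : twalg_sort := Twsp oneP.
Definition twalg_scal (c : F) : twalg_sort := Twsp (scalP c).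

Let tmulA : associative twalg_mul.
Proof. by move=> x y z; apply/val_inj/(@mulrA T). Qed.
Let tmul1 : left_id twalg_one twalg_mul.
Proof. by move=> x; apply/val_inj/(@mul1r T). Qed.
Let tmulr1 : right_id twalg_one twalg_mul.
Proof. by move=> x; apply/val_inj/(@mulr1 T). Qed.
Let tmulDl : left_distributive twalg_mul +%R.
Proof.
by move=> x y z; apply: val_inj; exact: (@mulrDl T (twval x) (twval y) (twval z)).
Qed.
Let tmulDr : right_distributive twalg_mul +%R.
Proof.
by move=> x y z; apply: val_inj; exact: (@mulrDr T (twval x) (twval y) (twval z)).
Qed.

HB.instance Definition _ := GRing.Zmodule_isPzRing.Build twalg_sort
  tmulA tmul1 tmulr1 tmulDl tmulDr.

Let tscal1 : twalg_scal 1 = 1.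
Proof. by apply/val_inj/(@scal1 F T). Qed.
Let tscalD : {morph twalg_scal : a b / a + b}.
Proof. by move=> a b; apply: val_inj; apply: (@scalD F T). Qed.
Let tscalM : {morph twalg_scal : a b / a * b}.
Proof. by move=> a b; apply/val_inj/(@scalM F T). Qed.
Let tscalC a x : twalg_scal a * x = x * twalg_scal a.
Proof. by apply/val_inj/(@scalC F T). Qed.

HB.instance Definition _ := isUnitalAlgebra.Build F twalg_sort
  tscal1 tscalD tscalM tscalC.

Definition twalg_comp (g : G) : {pred vsp twalg_sort^o} :=
  [pred x : twalg_sort | twval x \in twcomp (acomp A) g].

Lemma talgZ c (x : tensor (vsp (tga alpha)^o) (vsp A^o)) :
  (scal c : T) * x = c *: x.
Proof.
by rewrite [LHS]tactZl; congr (c *: _); apply: tact1.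
Qed.

Lemma twalg_grading : is_grading twalg_comp.
Proof.
apply: (@is_grading_twsp _ (acomp A) (vsp twalg_sort^o) id) => //.
- by move=> a x; apply: talgZ.
- by exists id.
Qed.

Lemma twalgM g h (a b : twalg_sort) : a \in twalg_comp g -> b \in twalg_comp h ->
  a * b \in twalg_comp (g * h)%g.
Proof. exact: (tact_twcomp (W := A^o) (@acompM G F A)). Qed.

Definition twalg : gradedAlg G F :=
  @GradedAlg G F twalg_sort (Grading twalg_grading) twalgM.

End TwistAlg.

Section TwistMod.
Variables (A : gradedAlg G F) (W : gradedMod A).
Local Notation T := (tmod (tga alpha)^o W).

Definition twmod_sort : Type := twsp (mcomp W).
HB.instance Definition _ := GRing.Zmodule.on twmod_sort.

Definition twmod_scale (x : twalg A) (w : twmod_sort) : twmod_sort :=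
  Twsp (tact_twsum (@mcompZ _ _ _ W) (twvalP x) (twvalP w)).

Let scaleA x y w : twmod_scale x (twmod_scale y w) = twmod_scale (x * y) w.
Proof. by apply: val_inj; apply: tactA. Qed.
Let scale1 : left_id 1 twmod_scale.
Proof. by move=> w; apply: val_inj; apply: tact1. Qed.
Let scaleDr : right_distributive twmod_scale +%R.
Proof.
by move=> x u v; apply: val_inj; apply: tactDr.
Qed.
Let scaleDl w : {morph twmod_scale^~ w : x y / x + y}.
Proof.
by move=> x y; apply: val_inj; apply: tactDl.
Qed.

HB.instance Definition _ := GRing.Zmodule_isLmodule.Build (twalg A) twmod_sort
  scaleA scale1 scaleDr scaleDl.

Definition twmod_comp (g : G) : {pred vsp twmod_sort} :=
  [pred w : twmod_sort | twval w \in twcomp (mcomp W) g].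

Lemma twmod_grading : is_grading twmod_comp.
Proof.
apply: (@is_grading_twsp _ (mcomp W) (vsp twmod_sort) id) => //.
- by move=> a w; rewrite [LHS]tactZl; congr (a *: _); apply: tact1.
- by exists id.
Qed.

Lemma twmodZ g h (x : twalg A) (w : twmod_sort) :
  x \in acomp (twalg A) g -> w \in twmod_comp h -> x *: w \in twmod_comp (g * h)%g.
Proof. exact: (tact_twcomp (@mcompZ _ _ _ W)). Qed.

Definition twmod : gradedMod (twalg A) := GradedMod (mcomp := Grading twmod_grading) twmodZ.

End TwistMod.
End Twist.

Section Suspension.
Variables (G : groupType) (F : fieldType) (A : gradedAlg G F).

Lemma suspZ (g : G) (W : gradedMod A) h k (a : A) (w : W) :
  a \in acomp A h -> w \in shift (mcomp W) g k ->
  a *: w \in shift (mcomp W) g (h * k)%g.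
Proof. by move=> aA wW; have := mcompZ (h := (k * g)%g) aA wW; rewrite mulgA. Qed.

Definition susp (g : G) (W : gradedMod A) : gradedMod A :=
  GradedMod (mcomp := shift (mcomp W) g) (@suspZ g W).

Definition graded_iso (W W' : gradedMod A) : Prop :=
  exists f : {linear W -> W'}, bijective f /\
    forall g (w : W), w \in mcomp W g -> f w \in mcomp W' g.

Definition inertia (W : gradedMod A) : set G :=
  [set g | graded_iso W (susp g W)]%classic.

End Suspension.

(* Main.v *)
Require Import Defs.
From HB Require Import structures.
From mathcomp Require Import all_boot all_order all_algebra.
From mathcomp Require Import boolp classical_sets.
From mathcomp Require Import monalg.

Set Implicit Arguments.
Unset Strict Implicit.
Unset Printing Implicit Defensive.

(** Two constructions carry the proof.

    The suspension isomorphism is right multiplication by a homogeneous unit.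
    In F^alpha G the element v_g has an inverse u, a scalar multiple of
    v_{g^-1}.  The map z |-> z (u ⊗ 1) commutes with every left action, it is
    undone by right multiplication by v_g, and it sends F v_{kg} ⊗ W_{kg} onto
    F v_k ⊗ W_{kg}: the degree kg component of alpha(W), which is the degree k
    component of g(alpha(W)), goes onto the degree k component of
    alpha(g(W)).  This is [susp_twmod].

    For the inertia, twisting must both preserve and reflect graded
    isomorphism ([graded_iso_twmod]).  Untwisting back by alpha^-1 would compare
    modules over two merely isomorphic algebras; instead, the linear bijection
    [untwist], which sends v_g ⊗ w to w for w in W_g, transports graded
    isomorphisms in both directions.  It is not a module morphism, but for x of
    degree g and z of degree h it multiplies the action by the scalar
    alpha(g, h), and this scalar depends on the degrees only, so it is the
    same on both sides of the equation f(a w) = a f(w).  Checking that equation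
    on homogeneous elements is enough ([graded_isoI]).

    Then W ≅ g(W) iff alpha(W) ≅ alpha(g(W)) iff alpha(W) ≅ g(alpha(W)). *)

Import GRing.Theory.
Local Open Scope ring_scope.

(** * Homogeneous components *)

Section GradedSpaces.
Variables (G : groupType) (F : fieldType).

Lemma grading_ind (V : lmodType F) (V_ : grading G V) (P : V -> Prop) :
    (forall g v, v \in V_ g -> P v) -> (forall v w, P v -> P w -> P (v + w)) ->
  forall v, P v.
Proof.
move=> Phom PD v; have [V_sub V_sum _] := gcompP V_.
have /asboolP[s [e [eV ->]]] := V_sum v.
apply: (big_ind P) => // [|g _]; last exact: Phom (eV g).
by apply: (Phom 1%g); case: (V_sub 1%g).
Qed.

(** The sum has two decompositions, the given one and itself in degree g alone;
    independence makes them agree term by term. *)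
Lemma homogeneous_component (V : lmodType F) (V_ : grading G V) (s : seq G)
    (e : G -> V) (g : G) :
    uniq s -> (forall h, e h \in V_ h) -> \sum_(h <- s) e h \in V_ g ->
  \sum_(h <- s) e h = if g \in s then e g else 0.
Proof.
move=> s_uniq eV; have [V_sub _ V_ind] := gcompP V_.
set x := \sum_(h <- s) e h => xV; set y := if _ then _ else _.
have [V0 VL] := V_sub g.
have yV : y \in V_ g by rewrite /y; case: ifP.
(* The difference of the two decompositions; g is put in front of s because it
   may be missing from s. *)
pose e' h := if h == g then y - x else e h.
have e'g : e' g = y - x by rewrite /e' eqxx.
have e'rem : \sum_(h <- rem g s) e' h = \sum_(h <- rem g s) e h.
  by apply: eq_big_seq => h; rewrite mem_rem_uniq // /e' inE => /andP[/negPf->].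
apply/esym/eqP; rewrite -subr_eq0 -e'g; apply/eqP.
apply: (V_ind (g :: rem g s)); last exact: mem_head.
- by rewrite /= mem_rem_uniqF ?rem_uniq.
- move=> h; rewrite /e'; case: eqP => [->|_]; last exact: eV.
  by rewrite addrC -scaleN1r; apply: VL.
- rewrite big_cons e'g e'rem /y /x; case: ifPn => gs.
    by rewrite (big_rem g gs) /= opprD addrA subrr add0r addNr.
  by rewrite rem_id // add0r addNr.
Qed.

(** The image of the decomposition of v is a decomposition of f v, which has a
    single term when f v is homogeneous; injectivity brings this back to v.
    This is why the inverse of a degree-preserving bijection preserves
    degrees. *)
Lemma homogeneous_preim (V V' : lmodType F) (V_ : grading G V)
    (V'_ : grading G V') (f : V -> V') :
    {morph f : v w / v + w} -> injective f ->
    (forall g v, v \in V_ g -> f v \in V'_ g) ->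
  forall g v, f v \in V'_ g -> v \in V_ g.
Proof.
move=> fD f_inj fV g v; have [V_sub V_sum _] := gcompP V_.
have f0 : f 0 = 0 by apply: (addrI (f 0)); rewrite -fD !addr0.
have [s [e [s_uniq eV ->]]] := sumsub_decomp V_sub (V_sum v).
have feE : f (\sum_(h <- s) e h) = \sum_(h <- s) f (e h).
  exact: (big_morph f fD f0).
move=> fvV; suff -> : \sum_(h <- s) e h = if g \in s then e g else 0.
  by case: ifP => _; [apply: eV | case: (V_sub g)].
apply: f_inj; rewrite [LHS]feE (@homogeneous_component _ V'_ _ _ g) -?feE //.
  by case: ifP; rewrite ?f0.
by move=> h; apply: fV (eV h).
Qed.

End GradedSpaces.

(** * Graded isomorphisms *)

Section GradedIso.
Variables (G : groupType) (F : fieldType) (A : gradedAlg G F).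
Implicit Types W : gradedMod A.

(** Both arguments of the action are sums of homogeneous elements and the
    action is biadditive, so an additive map is linear as soon as it is so on
    homogeneous elements. *)
Lemma graded_isoI W W' (f : W -> W') :
    {morph f : v w / v + w} -> bijective f ->
    (forall g w, w \in mcomp W g -> f w \in mcomp W' g) ->
    (forall g h (a : A) (w : W), a \in acomp A g -> w \in mcomp W h ->
       f (a *: w) = a *: f w) ->
  graded_iso W W'.
Proof.
move=> fD f_bij f_deg fZ.
have f_lin : linear f.
  move=> a v w; rewrite fD; congr (_ + _).
  elim/(grading_ind (V_ := acomp A)): a => [g a aA|a b IHa IHb]; last first.
    by rewrite !scalerDl fD IHa IHb.
  elim/(grading_ind (V_ := mcomp W)): v => [h v vW|v v' IHv IHv'].
    exact: fZ aA vW.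
  by rewrite scalerDr !fD scalerDr IHv IHv'.
pose fL : {linear W -> W'} := HB.pack f (GRing.isLinear.Build A W W' _ f f_lin).
by exists fL.
Qed.

Lemma graded_iso_sym W W' : graded_iso W W' -> graded_iso W' W.
Proof.
case=> f [[f' fK f'K] f_deg].
have f'D : {morph f' : v w / v + w}.
  by move=> v w; apply: (can_inj fK); rewrite raddfD /= !f'K.
have f_inj := can_inj fK.
apply: (graded_isoI (f := f')) => //.
- by exists f.
- move=> g w; rewrite -[w in w \in _]f'K.
  exact: (homogeneous_preim (V_ := mcomp W) (V'_ := mcomp W') (raddfD f)).
- by move=> g h a w _ _; apply: f_inj; rewrite linearZ /= !f'K.
Qed.

Lemma graded_iso_trans W1 W2 W3 :
  graded_iso W1 W2 -> graded_iso W2 W3 -> graded_iso W1 W3.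
Proof.
move=> [f [f_bij f_deg]] [h [h_bij h_deg]]; exists (h \o f)%FUN.
by split=> [|g w wW]; [apply: bij_comp | apply/h_deg/f_deg].
Qed.

End GradedIso.

(** The scalars of F act through the base algebra B. *)
Lemma linear_vspZ (F : fieldType) (B : unitalAlgType F) (U U' : lmodType B)
    (f : {linear U -> U'}) c (u : vsp U) : f (c *: u) = c *: (f u : vsp U').
Proof. exact: linearZ. Qed.

(** * Untwisting *)

Section Untwist.
Variables (G : groupType) (F : fieldType) (alpha : cocycle2 G F).

(** The augmentation of the group algebra.  For the twisted product it is
    multiplicative only up to alpha: v_g v_h is sent to alpha(g, h). *)
Definition aug (x : {malg F[G]}) : F := mmap idfun (fun=> 1) x.

Lemma augD : {morph aug : x y / x + y}.
Proof. exact: mmapD. Qed.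

Lemma augZ a x : aug (a *: x) = a * aug x.
Proof.
rewrite /aug (mmapEw (msuppZ_le a x)) mmapE mulr_sumr.
by apply: eq_bigr => g _; rewrite /= mcoeffZ !mulr1.
Qed.

Lemma aug_vg g : aug (vg alpha g) = 1.
Proof. by rewrite /aug mmapU mulr1. Qed.

Section Space.
Variables (V : lmodType F) (V_ : grading G V).
Local Notation T := (tensor (vsp (tga alpha)^o) V).

Definition untw : T -> V :=
  tlift (fun (x : vsp (tga alpha)^o) v => aug x *: v).

Let untw_bil : @bilinear_map F (vsp (tga alpha)^o) V V
  (fun x v => aug x *: v).
Proof.
split=> [x y v|x v w|a x v|a x v].
- by rewrite augD scalerDl.
- by rewrite scalerDr.
- by rewrite tgaZ augZ scalerA.
- by rewrite !scalerA mulrC.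
Qed.

Lemma untwD : {morph untw : x y / x + y}.
Proof. exact: (tliftD untw_bil). Qed.

Lemma untw0 : untw 0 = 0.
Proof. exact: (tlift0 untw_bil). Qed.

Lemma untwZ a : {morph untw : x / a *: x}.
Proof. exact: (tliftZ untw_bil). Qed.

Lemma untw_vtens g v : untw (vtens alpha g v) = v.
Proof. by rewrite [LHS](tlift_pure untw_bil) aug_vg scale1r. Qed.

Lemma untw_twcomp g x : x \in twcomp V_ g -> untw x \in V_ g.
Proof. by case/asboolP=> v vV ->; rewrite untw_vtens. Qed.

(** On the whole tensor product the map forgets the group element; on
    the sum of the F v_g ⊗ V_g the degree of v remembers it, by independence of
    the V_g. *)
Lemma untw_inj x : x \in twsum V_ -> untw x = 0 -> x = 0.
Proof.
case/(sumsub_decomp (twcomp_submod alpha V_))=> s [e [s_uniq eV ->]].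
rewrite (big_morph untw untwD untw0) => sum0; rewrite big_seq big1 // => g gs.
have [_ _ V_ind] := gcompP V_.
have := V_ind s _ s_uniq (fun h => untw_twcomp (eV h)) sum0 g gs.
by have /asboolP[v _ ->] := eV g; rewrite untw_vtens => ->; apply: pure0r.
Qed.

Lemma untw_surj v : exists2 x, x \in twsum V_ & untw x = v.
Proof.
have tw_sub := twcomp_submod alpha V_.
elim/(grading_ind (V_ := V_)): v => [g v vV|_ _ [x xT <-] [y yT <-]].
  exists (vtens alpha g v); last exact: untw_vtens.
  by apply: (sumsub_comp tw_sub (g := g)); apply/asboolP; exists v.
by exists (x + y); [apply: sumsubD | apply: untwD].
Qed.

Definition untwist (x : twsp alpha V_) : V := untw (twval x).

Lemma untwistD : {morph untwist : x y / x + y}.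
Proof. by move=> x y; rewrite /untwist twvalD untwD. Qed.

Lemma untwist_inj : injective untwist.
Proof.
move=> x y xy; apply/eqP; rewrite -subr_eq0; apply/eqP/val_inj.
apply: untw_inj (twvalP _) _; rewrite -[LHS]/(untwist (x - y)).
by apply: (addIr (untwist y)); rewrite -untwistD subrK xy add0r.
Qed.

Lemma untwist_bij : bijective untwist.
Proof.
have /choice[t tK] : forall v, exists x, untwist x = v.
  by move=> v; have [x xT <-] := untw_surj v; exists (Twsp xT).
by exists t => // x; apply: untwist_inj; apply: tK.
Qed.

End Space.

Section Module.
Variables (A : gradedAlg G F) (W : gradedMod A).

Lemma untwist_comp g (z : twmod alpha W) :
  (z \in mcomp (twmod alpha W) g) = (untwist z \in mcomp W g).
Proof.
apply/idP/idP; first exact: untw_twcomp.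
apply: (homogeneous_preim (V_ := mcomp (twmod alpha W)) (V'_ := mcomp W)
  (f := @untwist _ (mcomp W))).
- exact: untwistD.
- exact: untwist_inj.
- by move=> h x; apply: untw_twcomp.
Qed.

Lemma untwistZ c (z : vsp (twmod alpha W)) :
  untwist (c *: z : twmod alpha W) = c *: (untwist z : vsp W).
Proof.
rewrite -untwZ; congr untw.
by rewrite [LHS]tactZl; congr (c *: _); apply: tact1.
Qed.

(** The defect of linearity of [untwist] is a scalar depending only on the
    degrees: v_g v_h = alpha(g, h) v_{gh}. *)
Lemma untwist_act g h (x : twalg alpha A) (z : twmod alpha W) :
    x \in acomp (twalg alpha A) g -> z \in mcomp (twmod alpha W) h ->
  untwist (x *: z) = alpha g h *: ((untwist x : A) *: (untwist z : W) : vsp W).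
Proof.
move=> /asboolP[a _ xE] /asboolP[w _ zE].
have xzE := tact_vtens alpha g h a w; rewrite -xE -zE in xzE.
by rewrite /untwist [twval (x *: z)]xzE xE zE !untw_vtens.
Qed.

End Module.

Variable A : gradedAlg G F.

Lemma untwist_alg_comp g (a : A) : a \in acomp A g ->
  exists2 x : twalg alpha A, x \in acomp (twalg alpha A) g & untwist x = a.
Proof.
move=> aA; have tw_sub := twcomp_submod alpha (acomp A).
have xT : vtens alpha g (a : vsp A^o) \in twcomp (acomp A) g.
  by apply/asboolP; exists a.
by exists (Twsp (sumsub_comp tw_sub xT)); [| apply: untw_vtens].
Qed.

(** Conjugation by [untwist] turns graded isomorphisms of modules over A into
    graded isomorphisms over alpha(A) and back: in f(a w) = a f(w) the factor
    alpha(g, h) of [untwist_act] appears on both sides, since f keeps the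
    degree of w, and it is invertible. *)
Lemma graded_iso_twmod (W W' : gradedMod A) :
  graded_iso (twmod alpha W) (twmod alpha W') <-> graded_iso W W'.
Proof.
have [t tK Kt] := untwist_bij (mcomp W).
have [t' t'K Kt'] := untwist_bij (mcomp W').
have tD : {morph t : v w / v + w}.
  by move=> v w; apply: (can_inj tK); rewrite untwistD !Kt.
have t'D : {morph t' : v w / v + w}.
  by move=> v w; apply: (can_inj t'K); rewrite untwistD !Kt'.
split=> -[f [f_bij f_deg]].
- apply: (graded_isoI (f := fun w => untwist (f (t w)))).
  + by move=> v w; rewrite tD raddfD untwistD.
  + apply: (bij_comp (f := @untwist _ (mcomp W')) (h := f \o t)).
      exact: untwist_bij.
    by apply: bij_comp f_bij _; exists (@untwist _ (mcomp W)).
  + by move=> g w wW; rewrite -untwist_comp; apply: f_deg; rewrite untwist_comp Kt.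
  + move=> g h a w aA wW; have [x xA xE] := untwist_alg_comp aA.
    have tW : t w \in mcomp (twmod alpha W) h by rewrite untwist_comp Kt.
    apply: (scalerI (V := vsp W') (coc_neq0 alpha g h)).
    rewrite -xE -(untwist_act xA (f_deg _ _ tW)) -linearZ -untwistZ -linear_vspZ.
    congr (untwist (f _)); apply: (can_inj tK).
    by rewrite untwistZ Kt (untwist_act xA tW) Kt.
- apply: (graded_isoI (f := fun z : twmod alpha W => t' (f (untwist z)) : twmod alpha W')).
  + by move=> v w; rewrite untwistD raddfD t'D.
  + apply: (bij_comp (f := t') (h := f \o @untwist _ (mcomp W))).
      by exists (@untwist _ (mcomp W')).
    exact: bij_comp f_bij (untwist_bij (mcomp W)).
  + move=> g z zW; rewrite untwist_comp Kt'; apply: f_deg.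
    by rewrite -untwist_comp.
  + move=> g h x z xA zW; apply: (can_inj t'K); rewrite Kt'.
    rewrite (untwist_act xA zW) linear_vspZ linearZ.
    rewrite (untwist_act (h := h) xA) ?Kt' //.
    by rewrite untwist_comp Kt'; apply: f_deg; rewrite -untwist_comp.
Qed.

End Untwist.

(** * Right multiplication by the twisted group algebra *)

Section RightMultiplication.
Variables (G : groupType) (F : fieldType) (alpha : cocycle2 G F).

Section Space.
Variable V : lmodType F.
Local Notation T := (tensor (vsp (tga alpha)^o) V).
Implicit Types (u : tga alpha) (z : T).

Let rmul_fun u (x : vsp (tga alpha)^o) (v : V) : T :=
  pure ((x : tga alpha) * u : vsp (tga alpha)^o) v.

Let rmul_bil u : bilinear_map (rmul_fun u).
Proof.
have mulZ a (x : vsp (tga alpha)^o) :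
    ((a *: x : tga alpha) * u : vsp (tga alpha)^o) =
    a *: ((x : tga alpha) * u : vsp (tga alpha)^o).
  by rewrite [RHS]vspZ [a *: x]vspZ; apply/esym/mulrA.
split=> [x y v|x v w|a x v|a x v]; rewrite /rmul_fun.
- by rewrite mulrDl pureDl.
- exact: pureDr.
- by rewrite mulZ pureZl.
- exact: pureZr.
Qed.

(** The endomorphism z |-> z (u ⊗ 1) of F^alpha G ⊗ V: the first factor
    is a bimodule over itself. *)
Definition rmul u : T -> T := tlift (rmul_fun u).

Lemma rmulD u : {morph rmul u : x y / x + y}.
Proof. exact: (tliftD (rmul_bil u)). Qed.

Lemma rmul0 u : rmul u 0 = 0.
Proof. exact: (tlift0 (rmul_bil u)). Qed.

Lemma rmul_pure u (x : tga alpha) v :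
  rmul u (pure (x : vsp (tga alpha)^o) v) = pure (x * u : vsp (tga alpha)^o) v.
Proof. exact: (tlift_pure (rmul_bil u)). Qed.

Lemma rmulK u u' : u * u' = 1 -> cancel (rmul u) (rmul u').
Proof.
move=> uu' z; elim/tensor_ind: z => [|x v z IHz]; first by rewrite !rmul0.
by rewrite !rmulD IHz !rmul_pure -mulrA uu' mulr1.
Qed.

(** The first factor moves from degree k to degree kh while the second stays
    put, so the second must be read in a grading where its degree has moved in
    the same way. *)
Lemma rmul_twcomp (V_ V'_ : grading G V) c h k z :
    (forall v, v \in V_ k -> v \in V'_ (k * h)%g) ->
  z \in twcomp V_ k -> rmul << c *g h >> z \in twcomp V'_ (k * h)%g.
Proof.
move=> sV /asboolP[v vV ->]; apply/asboolP.
exists ((c * alpha k h) *: v).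
  have [+ _ _] := gcompP V'_ => /(_ (k * h)%g)[V0 VL].
  by rewrite -[_ *: _]addr0; apply: VL; first exact: sV.
rewrite rmul_pure tga_mulUU mul1r /vtens -pureZ tgaZ; congr pure.
by apply/malgP=> l; rewrite mcoeffZ !mcoeffU mulrnAr mulr1.
Qed.

Lemma rmul_twsum (V_ V'_ : grading G V) c h z :
    (forall k v, v \in V_ k -> v \in V'_ (k * h)%g) ->
  z \in twsum V_ -> rmul << c *g h >> z \in twsum V'_.
Proof.
move=> sV /asboolP[s [e [eV ->]]]; have tw_sub := twcomp_submod alpha V'_.
rewrite (big_morph _ (rmulD _) (rmul0 _)).
apply: (big_ind (fun y => y \in twsum V'_)); first exact: sumsub0.
  by move=> ? ?; apply: sumsubD.
by move=> k _; apply: (sumsub_comp tw_sub); apply: rmul_twcomp (sV k) (eV k).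
Qed.

End Space.

(** On pure tensors this is associativity in F^alpha G. *)
Lemma tact_rmul (A : unitalAlgType F) (W : lmodType A) (u : tga alpha)
    (x : talg (tga alpha) A) (z : tmod (tga alpha)^o W) :
  rmul u (tact x z) = tact x (rmul u z).
Proof.
elim/tensor_ind: x => [|b a x IHx]; first by rewrite !tact0l rmul0.
rewrite !tactDl rmulD IHx; congr (_ + _) => {IHx}.
elim/tensor_ind: z => [|c w z IHz]; first by rewrite tact0r rmul0 tact0r.
rewrite tactDr !rmulD tactDr IHz; congr (_ + _).
by rewrite rmul_pure !tact_pure rmul_pure; congr pure; apply/esym/mulrA.
Qed.

Lemma vg_inv g : exists c,
  vg alpha g * (<< c *g g^-1%g >> : tga alpha) = 1 /\
  (<< c *g g^-1%g >> : tga alpha) * vg alpha g = 1.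
Proof.
have coc_invC : alpha g^-1%g g = alpha g g^-1%g.
  have := cocP alpha g g^-1%g g; rewrite mulgV mulVg coc1g cocg1.
  by move/(mulIf (coc_neq0 alpha 1%g 1%g)).
(* v_g v_{g^-1} = alpha(g, g^-1) v_1, and the unit is alpha(1, 1)^-1 v_1. *)
exists (alpha g g^-1%g * alpha 1%g 1%g)^-1.
rewrite !tga_mulUU mulgV mulVg mul1r mulr1 coc_invC.
by rewrite invfM mulrAC mulVf ?coc_neq0 ?mul1r.
Qed.

(** Right multiplication by the inverse of v_g.  In coordinates it is
    v_{kg} ⊗ w |-> alpha(k, g)^-1 v_k ⊗ w, whose linearity is the cocycle
    identity; as a multiplication it is linear by associativity. *)
Lemma susp_twmod (A : gradedAlg G F) (W : gradedMod A) g :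
  graded_iso (susp g (twmod alpha W)) (twmod alpha (susp g W)).
Proof.
have [c [vgu uvg]] := vg_inv g.
set u : tga alpha := << _ *g _ >> in vgu uvg.
have sV k (w : W) : w \in mcomp W k -> w \in mcomp (susp g W) (k * g^-1)%g.
  by rewrite [_ \in mcomp (susp _ _) _]/(w \in mcomp W _) mulgVK.
have sV' k (w : W) : w \in mcomp (susp g W) k -> w \in mcomp W (k * g)%g by [].
pose f (z : twmod alpha W) : twmod alpha (susp g W) :=
  Twsp (rmul_twsum (V'_ := mcomp (susp g W)) c sV (twvalP z)).
pose f' (z : twmod alpha (susp g W)) : twmod alpha W :=
  Twsp (rmul_twsum (V'_ := mcomp W) 1 sV' (twvalP z)).
apply: (graded_isoI (W := susp g (twmod alpha W)) (f := f)).
- by move=> x y; apply/val_inj/rmulD.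
- exists f' => z; apply/val_inj; [exact: (rmulK uvg) | exact: (rmulK vgu)].
- move=> k z zW; have := rmul_twcomp (V'_ := mcomp (susp g W)) c (sV (k * g)%g) zW.
  by rewrite mulgK.
- by move=> h k x z _ _; apply/val_inj/tact_rmul.
Qed.

End RightMultiplication.

Theorem corollary5p10 (G : groupType) (F : fieldType) (A : gradedAlg G F)
    (W : gradedMod A) (alpha : cocycle2 G F) :
  (forall g : G,
     graded_iso (susp g (twmod alpha W)) (twmod alpha (susp g W))) /\
  inertia W = inertia (twmod alpha W).
Proof.
split=> [g|]; first exact: susp_twmod.
apply/seteqP; split=> g /=.
  move=> /graded_iso_twmod - /(_ alpha) isoW; apply: graded_iso_trans isoW _.
  exact/graded_iso_sym/susp_twmod.
move=> isoW; apply/(graded_iso_twmod alpha).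
exact: graded_iso_trans isoW (susp_twmod _ _ _).
Qed.
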